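(* Every poset space has the property of Baire: for every poset $P$, if $X$ is $\mathrm{MF}(P)$ or $\mathrm{UF}(P)$, then the intersection of any sequence $(U_i)_{i\in\mathbb{N}}$ of dense open subsets of $X$ is dense in $X$.
   Context: A poset is a set $P$ with a reflexive, antisymmetric, transitive relation $\preceq$; $p\prec q$ means $p\preceq q$ and $p\neq q$. A filter on $P$ is a nonempty subset $F\subseteq P$ such that (1) for all $p,q\in F$ there is $r\in F$ with $r\preceq p$ and $r\preceq q$, and (2) if $p\in F$, $q\in P$ and $p\preceq q$ then $q\in F$. A filter $F$ is unbounded if there is no $r\in P$ with $r\prec q$ for every $q\in F$; it is maximal if no strictly larger filter contains it (every maximal filter is unbounded). $\mathrm{UF}(P)$ is the set of unbounded filters on $P$, with the topology having basis $\{N_p : p\in P\}$, where $N_p=\{F\in \mathrm{UF}(P) : p\in F\}$; $\mathrm{MF}(P)\subseteq \mathrm{UF}(P)$ is the set of maximal filters, with the subspace topology. A poset space is a space of the form $\mathrm{MF}(P)$ or $\mathrm{UF}(P)$. *)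

(* Defs.v *)
From HB Require Import structures.
From mathcomp Require Import all_boot all_order.
From mathcomp Require Import all_classical topology.

Set Implicit Arguments.
Unset Strict Implicit.
Unset Printing Implicit Defensive.

Import Order.TTheory.
Local Open Scope classical_set_scope.
Local Open Scope order_scope.

Section PosetFilters.
Context {d : Order.disp_t} {P : porderType d}.
Implicit Types F G : set P.

Definition poset_filter F : Prop :=
  [/\ F !=set0,
      forall p q, F p -> F q -> exists r, [/\ F r, r <= p & r <= q]
    & forall p q, F p -> p <= q -> F q].

Definition unbounded_filter F : Prop :=
  poset_filter F /\ ~ (exists r : P, forall q, F q -> r < q).

Definition maximal_filter F : Prop :=
  poset_filter F /\ ~ (exists G, poset_filter G /\ F `<` G).

(* Hence nothing is lost in [MF] below by collecting the maximal filters
   among the unbounded ones. *)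
Lemma maximal_filter_unbounded F : maximal_filter F -> unbounded_filter F.
Proof.
move=> [fF maxF]; split=> // -[r rF]; apply: maxF.
exists [set q | r <= q]; split.
  split; first by exists r => /=.
    by move=> p q /= rp rq; exists r; split=> /=.
  by move=> p q /= rp pq; exact: le_trans rp pq.
split; first by move=> q /rF /ltW.
by move=> /(_ r (lexx r)) /rF; rewrite ltxx.
Qed.

End PosetFilters.

Record UF {d : Order.disp_t} (P : porderType d) := MkUF {
  uf_set :> set P;
  uf_unbounded : unbounded_filter uf_set
}.

Definition UF_nbhd {d : Order.disp_t} {P : porderType d} (p : P) : set (UF P) :=
  [set F : UF P | uf_set F p].

Section UFTopology.
Context {d : Order.disp_t} {P : porderType d}.

HB.instance Definition _ := gen_eqMixin (UF P).
HB.instance Definition _ := gen_choiceMixin (UF P).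

Let UF_cover : \bigcup_(B in range (@UF_nbhd d P)) B = [set: UF P].
Proof.
rewrite -subTset => F _; have [[[p Fp] _ _] _] := uf_unbounded F.
by exists (UF_nbhd p) => //; exists p.
Qed.

Let UF_join (B C : set (UF P)) (F : UF P) :
  range (@UF_nbhd d P) B -> range (@UF_nbhd d P) C -> B F -> C F ->
  exists D, [/\ range (@UF_nbhd d P) D, D F & D `<=` B `&` C].
Proof.
move=> [p _ <-] [q _ <-] Fp Fq; have [[_ dirF _] _] := uf_unbounded F.
have [r [Fr rp rq]] := dirF p q Fp Fq.
exists (UF_nbhd r); split=> //.
move=> G Gr; have [[_ _ upG] _] := uf_unbounded G.
by split; [exact: upG Gr rp|exact: upG Gr rq].
Qed.

(* The base is indexed by the sets N_p themselves rather than by P, since the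
   index type of [isBaseTopological] must be pointed and P may be empty. *)
HB.instance Definition _ :=
  @isBaseTopological.Build (UF P) (set (UF P)) (range (@UF_nbhd d P)) id
    UF_cover UF_join.

End UFTopology.

(* As a type, this set carries the library's subspace topology, initial for the
   inclusion into [UF P]. *)
Definition MF {d : Order.disp_t} (P : porderType d) : set (UF P) :=
  [set F : UF P | maximal_filter (uf_set F)].
Arguments MF {d} P _.

Definition property_of_Baire (X : topologicalType) : Prop :=
  forall U : nat -> set X,
    (forall i, open (U i) /\ dense (U i)) -> dense (\bigcap_i U i).

(* Main.v *)
(** The basic open sets [N_p] behave like the balls of a complete metric space:
    they form a base, they are nonempty (extend the principal filter of [p] to a
    maximal one), and along a descending sequence [p_0 >= p_1 >= ...] they have
    a common point (extend the filter generated by the sequence).  So the usual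
    Baire category argument, choosing [p_(i+1) <= p_i] with [N_(p_(i+1))]
    inside [U_i], produces a maximal filter, which lies both in MF(P) and
    in UF(P). *)
Require Import Defs.
From mathcomp Require Import all_boot all_order.
From mathcomp Require Import all_classical topology.

Set Implicit Arguments.
Unset Strict Implicit.
Unset Printing Implicit Defensive.

Import Order.TTheory.
Local Open Scope classical_set_scope.
Local Open Scope order_scope.

Section FilterExtension.
Context {d : Order.disp_t} {P : porderType d}.
Implicit Types F G : set P.

Lemma filter_sub_maximal F : poset_filter F ->
  exists G, maximal_filter G /\ F `<=` G.
Proof.
move=> fF; have [[p0 Fp0] dirF upF] := fF.
(* Adjoining [F] to every set makes the empty chain harmless in Zorn's lemma. *)
have [|A [fA maxA]] := @Zorn_bigcup P (fun A => poset_filter (A `|` F)).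
  move=> C fC totC; split.
  - by exists p0; right.
  - have dirC A p q : C A -> (A `|` F) p -> (A `|` F) q ->
        exists r, [/\ (\bigcup_(X in C) X `|` F) r, r <= p & r <= q].
      move=> CA Ap Aq; have [_ dirA _] := fC _ CA.
      have [r [Ar rp rq]] := dirA p q Ap Aq; exists r; split=> //.
      by case: Ar => [Ar|Fr]; [left; exists A|right].
    move=> p q [[A CA Ap]|Fp] [[B CB Bq]|Fq].
    + case: (totC _ _ CA CB) => [AB|BA].
        by apply: (dirC B) => //; left=> //; exact: AB.
      by apply: (dirC A) => //; left=> //; exact: BA.
    + by apply: (dirC A) => //; [left|right].
    + by apply: (dirC B) => //; [right|left].
    + by have [r [Fr rp rq]] := dirF p q Fp Fq; exists r; split=> //; right.
  - move=> p q [[A CA Ap]|Fp] pq; last by right; exact: upF Fp pq.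
    have [_ _ /(_ p q (or_introl Ap) pq) [Aq|Fq]] := fC _ CA; last by right.
    by left; exists A.
exists (A `|` F); split; last by move=> p; right.
(* A filter [G] strictly above the union of [A] and [F] contains [F], so adjoining [F] leaves it a
   filter, against the maximality of [A]. *)
split=> // -[G [fG [AFG nGAF]]]; apply: (maxA G).
  by split=> [p Ap|GA]; [apply: AFG; left|apply: nGAF => p /GA; left].
by rewrite setUidl // => p Fp; apply: AFG; right.
Qed.

Lemma descending_sub_maximal (p : nat -> P) :
  (forall n, p n.+1 <= p n) -> exists F, maximal_filter F /\ forall n, F (p n).
Proof.
move=> dp; have mono m n : (m <= n)%N -> p n <= p m.
  elim: n => [|n IHn]; first by rewrite leqn0 => /eqP ->.
  rewrite leq_eqVlt => /predU1P[->//|]; rewrite ltnS => /IHn.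
  exact: le_trans (dp n).
have [|F [maxF subF]] := @filter_sub_maximal [set q | exists n, p n <= q].
  split; first by exists (p 0), 0.
  - move=> q r [m pq] [n pr]; exists (p (maxn m n)); split.
    + by exists (maxn m n).
    + by apply: le_trans pq; apply: mono; rewrite leq_maxl.
    + by apply: le_trans pr; apply: mono; rewrite leq_maxr.
  - by move=> q r [n pq] qr; exists n; exact: le_trans qr.
by exists F; split=> // n; apply: subF; exists n.
Qed.

(** Reading [f x] as the filter of the point [x] lets one argument serve MF(P) and UF(P): both have
    the sets N_p as a base and every maximal filter as a point. *)
Lemma filter_space_Baire (X : topologicalType) (f : X -> set P) :
  (forall x, poset_filter (f x)) ->
  (forall p, open [set x | f x p]) ->
  (forall O x, open O -> O x ->
    exists2 p, f x p & [set y | f y p] `<=` O) ->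
  (forall F, maximal_filter F -> exists x, f x = F) ->
  property_of_Baire X.
Proof.
move=> filf openN baseN maxf U dU O [x0 Ox0] oO.
have [p0 _ p0O] := baseN _ _ oO Ox0.
have shrink (ip : nat * P) :
    exists q, q <= ip.2 /\ [set y | f y q] `<=` U ip.1.
  case: ip => i p /=; have [oU denseU] := dU i.
  (* The constant sequence at [p] shows that N_p is nonempty. *)
  have [F [maxF Fp]] := @descending_sub_maximal (fun=> p) (fun=> lexx p).
  have [x fx] := maxf _ maxF.
  have Np0 : [set y | f y p] !=set0 by exists x; rewrite /= fx; exact: (Fp 0).
  have [y [yp Uy]] := denseU _ Np0 (openN p).
  have [q yq qU] := baseN _ _ oU Uy.
  have [_ diry _] := filf y.
  (* [q] need not lie below [p], but both are in the filter of [y], which is directed. *)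
  have [r [_ rp rq]] := diry _ _ yp yq.
  exists r; split=> // z zr; apply: qU => /=.
  by have [_ _ upz] := filf z; exact: upz zr rq.
have [g gP] := choice shrink.
(* Stage [n] puts N_(p_(n+1)) inside [U n], while [p 0] is kept for [O]. *)
pose p := fix p n := if n is m.+1 then g (m, p m) else p0.
have [|F [maxF Fp]] := @descending_sub_maximal p.
  by move=> n; have [] := gP (n, p n).
have [x fx] := maxf _ maxF.
exists x; split; first by apply: p0O; rewrite /= fx; exact: (Fp 0).
move=> i _; have [_] := gP (i, p i); apply.
by rewrite /= fx; exact: (Fp i.+1).
Qed.

End FilterExtension.

Lemma open_UF_nbhd (d : Order.disp_t) (P : porderType d) (p : P) :
  open (UF_nbhd p).
Proof.
exists [set UF_nbhd p]; first by move=> _ ->; exists p.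
by rewrite bigcup_set1.
Qed.

Lemma UF_nbhd_base (d : Order.disp_t) (P : porderType d) (O : set (UF P)) F :
  open O -> O F -> exists2 p, uf_set F p & UF_nbhd p `<=` O.
Proof.
case=> D subD <- [B DB BF]; have [p _ pB] := subD _ DB.
exists p; first by rewrite -pB in BF.
by move=> G Gp; exists B => //; rewrite -pB.
Qed.

Theorem theorem5p1 (d : Order.disp_t) (P : porderType d) :
  property_of_Baire (set_type (MF P)) /\ property_of_Baire (UF P).
Proof.
split.
- apply: (@filter_space_Baire _ _ _ (fun F => uf_set (set_val F))).
  + by move=> F; have [] := uf_unbounded (set_val F).
  + by move=> p; exists (UF_nbhd p) => //; exact: open_UF_nbhd.
  (* Open sets of the subspace are traces of open sets of UF(P). *)
  + move=> _ F [O oO <-] OF; have [p Fp pO] := UF_nbhd_base oO OF.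
    by exists p => // G /pO.
  + move=> F maxF; pose F' := MkUF (maximal_filter_unbounded maxF).
    by exists (SigSub (mem_set (maxF : MF P F'))).
- apply: (@filter_space_Baire _ _ _ (@uf_set d P)).
  + by move=> F; have [] := uf_unbounded F.
  + exact: open_UF_nbhd.
  + exact: UF_nbhd_base.
  + by move=> F maxF; exists (MkUF (maximal_filter_unbounded maxF)).
Qed.
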